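(* Let $Y,Z$ be sets satisfying \[ \{\emptyset\}\otimes(\{\emptyset\}\cup Y)=Z \qquad\text{and}\qquad Y\subsetneq Z. \] Then $\mathrm{rk}(Z)<\omega$ and $|Z\setminus Y|=1$.
   Context: We work in ZFC with the Axiom of Regularity; $\mathrm{rk}$ denotes von Neumann rank. For sets $A,B$, the unordered Cartesian product is $A\otimes B := \{\{a,b\}\mid a\in A,\ b\in B\}$. *)

(* Defs.v *)
From Stdlib Require Import Classical ClassicalEpsilon.

Set Implicit Arguments.

(* First-order formulas of the language {=, ∈}, with de Bruijn variables; they
   are needed only to state the Separation and Replacement schemas, so that the
   structures below are exactly the (first-order) models of ZFC. *)
Inductive formula : Type :=
| FIn (i j : nat)
| FEq (i j : nat)
| FNot (phi : formula)
| FAnd (phi psi : formula)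
| FAll (phi : formula).

Definition scons (T : Type) (x : T) (e : nat -> T) (n : nat) : T :=
  match n with 0 => x | S m => e m end.

Declare Scope set_scope.
Delimit Scope set_scope with set.
Local Open Scope set_scope.

Notation "x .: e" := (scons x e) (at level 55, e at level 55, right associativity) : set_scope.

Fixpoint sat (T : Type) (In : T -> T -> Prop) (phi : formula) (e : nat -> T) : Prop :=
  match phi with
  | FIn i j => In (e i) (e j)
  | FEq i j => e i = e j
  | FNot phi => ~ sat In phi e
  | FAnd phi psi => sat In phi e /\ sat In psi e
  | FAll phi => forall x, sat In phi (x .: e)
  end.

(* Parameters of the schemas are the values of the environment [e]. *)
Record ZFC : Type := {
  universe :> Type;
  In : universe -> universe -> Prop;
  extensionality : forall a b, (forall x, In x a <-> In x b) -> a = b;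
  regularity : forall a, (exists x, In x a) ->
    exists x, In x a /\ forall y, In y x -> ~ In y a;
  pairing : forall a b, exists c, forall x, In x c <-> x = a \/ x = b;
  unions : forall a, exists c, forall x, In x c <-> exists y, In y a /\ In x y;
  powerset : forall a, exists c, forall x, In x c <-> forall y, In y x -> In y a;
  infinity : exists w,
    (exists x, In x w /\ forall y, ~ In y x) /\
    (forall x, In x w -> exists y, In y w /\ forall z, In z y <-> In z x \/ z = x);
  separation : forall (phi : formula) (e : nat -> universe) a,
    exists c, forall x, In x c <-> In x a /\ sat In phi (x .: e);
  replacement : forall (phi : formula) (e : nat -> universe) a,
    (forall x y z, In x a -> sat In phi (x .: y .: e) ->
       sat In phi (x .: z .: e) -> y = z) ->
    exists c, forall y, In y c <-> exists x, In x a /\ sat In phi (x .: y .: e);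
  choice : forall a,
    (forall x, In x a -> exists y, In y x) ->
    (forall x y z, In x a -> In y a -> In z x -> In z y -> x = y) ->
    exists c, forall x, In x a -> exists! y, In y c /\ In y x
}.

Arguments In {z} _ _.

Notation "x ∈ y" := (In x y) (at level 70, no associativity) : set_scope.
Notation "x ∉ y" := (~ In x y) (at level 70, no associativity) : set_scope.

Lemma ZFC_inhabited (V : ZFC) : inhabited V.
Proof. destruct (infinity V) as [w _]. exact (inhabits w). Qed.

(* The set whose elements are the [x] with [P x]; arbitrary if [P] is not the
   extension of a set. *)
Definition setof (V : ZFC) (P : V -> Prop) : V :=
  epsilon (ZFC_inhabited V) (fun s => forall x, x ∈ s <-> P x).

Definition empty {V : ZFC} : V := setof V (fun _ => False).

Notation "∅" := empty : set_scope.

Section Operations.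
Context {V : ZFC}.
Implicit Types a b x y A B f n w : V.

Definition upair a b : V := setof V (fun x => x = a \/ x = b).
Definition sing a : V := upair a a.
Definition cup A B : V := setof V (fun x => x ∈ A \/ x ∈ B).
Definition setminus A B : V := setof V (fun x => x ∈ A /\ x ∉ B).
Definition subset A B : Prop := forall x, x ∈ A -> x ∈ B.
Definition proper A B : Prop := subset A B /\ A <> B.

Definition uprod A B : V :=
  setof V (fun x => exists a b, a ∈ A /\ b ∈ B /\ x = upair a b).

Definition opair a b : V := upair (sing a) (upair a b).
Definition succ a : V := cup a (sing a).

Definition inductive w : Prop := ∅ ∈ w /\ forall n, n ∈ w -> succ n ∈ w.
Definition omega : V := setof V (fun n => forall w, inductive w -> n ∈ w).

(* [f] is (the graph of) a function with transitive domain satisfying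
   f(y) = ⋃ { f(u) + 1 | u ∈ y }. *)
Definition ranking f : Prop :=
  (forall p, p ∈ f -> exists y b, p = opair y b) /\
  (forall y b c, opair y b ∈ f -> opair y c ∈ f -> b = c) /\
  (forall y b u, opair y b ∈ f -> u ∈ y -> exists d, opair u d ∈ f) /\
  (forall y b, opair y b ∈ f ->
     forall c, c ∈ b <-> exists u d, u ∈ y /\ opair u d ∈ f /\ c ∈ succ d).

(* Von Neumann rank, by ∈-recursion carried out inside the model; ranks are von
   Neumann ordinals, ordered by ∈. *)
Definition rk x : V :=
  epsilon (ZFC_inhabited V) (fun b => exists f, ranking f /\ opair x b ∈ f).

End Operations.

Notation "A ∪ B" := (cup A B) (at level 50, left associativity) : set_scope.
Notation "A ∖ B" := (setminus A B) (at level 50, left associativity) : set_scope.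
Notation "A ⊗ B" := (uprod A B) (at level 40, left associativity) : set_scope.
Notation "A ⊆ B" := (subset A B) (at level 70, no associativity) : set_scope.
Notation "A ⊊ B" := (proper A B) (at level 70, no associativity) : set_scope.

Lemma setof_spec (V : ZFC) (P : V -> Prop) :
  (exists s : V, forall x, x ∈ s <-> P x) -> forall x, x ∈ setof V P <-> P x.
Proof. intros H. exact (epsilon_spec (ZFC_inhabited V) _ H). Qed.

Section Specifications.
Context {V : ZFC}.
Implicit Types a b x A B : V.

Lemma empty_spec x : x ∉ ∅.
Proof.
  destruct (infinity V) as [w [[e [_ He]] _]].
  unfold empty. rewrite setof_spec; [easy | exists e; firstorder].
Qed.

Lemma upair_spec a b x : x ∈ upair a b <-> x = a \/ x = b.
Proof. apply setof_spec. apply pairing. Qed.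

Lemma sing_spec a x : x ∈ sing a <-> x = a.
Proof. unfold sing. rewrite upair_spec. tauto. Qed.

Lemma cup_spec A B x : x ∈ A ∪ B <-> x ∈ A \/ x ∈ B.
Proof.
  apply (setof_spec V (fun x => x ∈ A \/ x ∈ B)).
  destruct (unions V (upair A B)) as [c Hc]. exists c. intros y. rewrite Hc.
  split.
  - intros [z [Hz Hy]]. apply upair_spec in Hz. destruct Hz; subst; tauto.
  - intros [H | H]; [exists A | exists B]; rewrite upair_spec; tauto.
Qed.

Lemma setminus_spec A B x : x ∈ A ∖ B <-> x ∈ A /\ x ∉ B.
Proof.
  apply (setof_spec V (fun x => x ∈ A /\ x ∉ B)).
  exact (separation V (FNot (FIn 0 1)) (fun _ => B) A).
Qed.

Lemma uprod_spec A B x :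
  x ∈ A ⊗ B <-> exists a b, a ∈ A /\ b ∈ B /\ x = upair a b.
Proof.
  apply (setof_spec V (fun x => exists a b, a ∈ A /\ b ∈ B /\ x = upair a b)).
  destruct (powerset V (A ∪ B)) as [p Hp].
  set (FEx := fun phi => FNot (FAll (FNot phi))).
  set (FImp := fun phi psi => FNot (FAnd phi (FNot psi))).
  set (FOr := fun phi psi => FNot (FAnd (FNot phi) (FNot psi))).
  set (FIff := fun phi psi => FAnd (FImp phi psi) (FImp psi phi)).
  (* innermost numbering: 0 = u, 1 = b, 2 = a, 3 = x, 4 = A, 5 = B *)
  set (phi := FEx (FEx (FAnd (FIn 1 3) (FAnd (FIn 0 4)
    (FAll (FIff (FIn 0 3) (FOr (FEq 0 2) (FEq 0 1)))))))).
  destruct (separation V phi (A .: B .: fun _ => A) p) as [c Hc].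
  exists c. intros y. rewrite Hc. cbn. split.
  - intros [_ H]. apply NNPP. intros N. apply H. intros a Ha. apply Ha.
    intros b [HA [HB Hu]]. apply N. exists a, b. split; [exact HA | split; [exact HB |]].
    apply extensionality. intros u. rewrite upair_spec.
    specialize (Hu u). tauto.
  - intros [a [b [HA [HB ->]]]]. split.
    + apply Hp. intros u Hu. apply upair_spec in Hu. apply cup_spec.
      destruct Hu; subst; tauto.
    + intros H. apply (H a). intros H'. apply (H' b). repeat split; trivial.
      * rewrite upair_spec. tauto.
      * rewrite upair_spec. tauto.
Qed.

End Specifications.

(* Main.v *)
From Stdlib Require Import Classical ClassicalEpsilon.
Require Import Defs.
Open Scope set_scope.

(** Put [W = {∅} ∪ Y] and [g u = {∅, u}], so that [Z] is the image of [W] under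
    the injection [g], and [W] is a transitive set all of whose nonempty elements
    are values [g u] with [u ∈ W].  By regularity [W] is generated from [∅] by
    [g].  Since [Y ≠ Z], some [b ∈ W] has [g b ∉ W].  The transitive closure of
    [{b}] is closed under [g] within [W] (an element [u ≠ b] belongs to it only
    because [g u] does), hence it is all of [W].  So [b] is unique, and [g b] is
    the only element of [Z ∖ Y].  Along the generation of [W] every rank is a
    natural number; all ranks on [W] are at most the rank [n] of [b], so that
    [g b] has rank [n + 1] and [Z] has rank [n + 2].

    All inductions take place inside the model, which need not be well-founded
    from outside: the induction predicates have to be first-order definable. *)

(** * Definable predicates *)

(** Needed to move a term under a further quantifier, where its variables are shifted. *)
Fixpoint rename (r : nat -> nat) (phi : formula) : formula :=
  match phi with
  | FIn i j => FIn (r i) (r j)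
  | FEq i j => FEq (r i) (r j)
  | FNot phi => FNot (rename r phi)
  | FAnd phi psi => FAnd (rename r phi) (rename r psi)
  | FAll phi => FAll (rename (fun n => match n with 0 => 0 | S m => S (r m) end) phi)
  end.

Lemma sat_rename (T : Type) (R : T -> T -> Prop) phi :
  forall r e e', (forall n, e' n = e (r n)) ->
  (sat R (rename r phi) e <-> sat R phi e').
Proof.
  induction phi as [i j|i j|phi IH|phi IH1 psi IH2|phi IH]; intros r e e' H; cbn.
  - now rewrite !H.
  - now rewrite !H.
  - now rewrite (IH r e e').
  - now rewrite (IH1 r e e'), (IH2 r e e').
  - split; intros K x; generalize (K x); apply IH; intros [|n]; cbn; auto.
Qed.

Section Definability.
Context {V : ZFC}.
Implicit Types (P Q : (nat -> V) -> Prop) (t s : (nat -> V) -> V).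

Definition definable P : Prop :=
  exists phi, forall e, sat (@In V) phi e <-> P e.

(** The language has no function symbols, so a term is represented by its graph: variable 0 is the
    value, the parameters start at 1. *)
Definition definable_term t : Prop :=
  definable (fun e => e 0 = t (fun n => e (S n))).

Lemma definable_iff P Q : (forall e, P e <-> Q e) -> definable P -> definable Q.
Proof. intros H [phi K]. exists phi. intros e. rewrite K. apply H. Qed.

Lemma definable_rename r P :
  definable P -> definable (fun e => P (fun n => e (r n))).
Proof.
  intros [phi K]. exists (rename r phi). intros e. rewrite <- K.
  now apply sat_rename.
Qed.

Lemma definable_not P : definable P -> definable (fun e => ~ P e).
Proof. intros [phi K]. exists (FNot phi). intros e. cbn. now rewrite K. Qed.

Lemma definable_and P Q :
  definable P -> definable Q -> definable (fun e => P e /\ Q e).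
Proof.
  intros [phi K] [psi L]. exists (FAnd phi psi). intros e. cbn. now rewrite K, L.
Qed.

Lemma definable_or P Q :
  definable P -> definable Q -> definable (fun e => P e \/ Q e).
Proof.
  intros HP HQ. apply definable_iff with (fun e => ~ (~ P e /\ ~ Q e)).
  - intros e. tauto.
  - apply definable_not, definable_and; now apply definable_not.
Qed.

Lemma definable_imp P Q :
  definable P -> definable Q -> definable (fun e => P e -> Q e).
Proof.
  intros HP HQ. apply definable_iff with (fun e => ~ P e \/ Q e).
  - intros e. tauto.
  - apply definable_or; [now apply definable_not | exact HQ].
Qed.

Lemma definable_equiv P Q :
  definable P -> definable Q -> definable (fun e => P e <-> Q e).
Proof. intros HP HQ. apply definable_and; now apply definable_imp. Qed.

Lemma definable_all (P : (nat -> V) -> V -> Prop) :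
  definable (fun e => P (fun n => e (S n)) (e 0)) ->
  definable (fun e => forall x, P e x).
Proof.
  intros [phi K]. exists (FAll phi). intros e. cbn.
  split; intros H x; apply (K (x .: e)), H.
Qed.

Lemma definable_ex (P : (nat -> V) -> V -> Prop) :
  definable (fun e => P (fun n => e (S n)) (e 0)) ->
  definable (fun e => exists x, P e x).
Proof.
  intros H. apply definable_iff with (fun e => ~ forall x, ~ P e x).
  - intros e. split.
    + intros N. apply NNPP. intros M. apply N. intros x Hx. apply M. now exists x.
    + intros [x Hx] N. exact (N x Hx).
  - apply definable_not, definable_all. now apply definable_not.
Qed.

Lemma definable_var i : definable_term (fun e => e i).
Proof. exists (FEq 0 (S i)). reflexivity. Qed.

Lemma definable_weaken t :
  definable_term t -> definable_term (fun e => t (fun n => e (S n))).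
Proof.
  exact (definable_rename (fun n => match n with 0 => 0 | S m => S (S m) end) _).
Qed.

Lemma definable_in t s :
  definable_term t -> definable_term s -> definable (fun e => t e ∈ s e).
Proof.
  intros Ht Hs.
  apply definable_iff with (fun e => exists x, x = t e /\ exists y, y = s e /\ x ∈ y).
  - intros e. split.
    + now intros [x [-> [y [-> H]]]].
    + intros H. exists (t e). split; [reflexivity | now exists (s e)].
  - apply definable_ex, definable_and; [exact Ht |].
    apply definable_ex, definable_and; [exact (definable_weaken _ Hs) |].
    exists (FIn 1 0). reflexivity.
Qed.

Lemma definable_eq t s :
  definable_term t -> definable_term s -> definable (fun e => t e = s e).
Proof.
  intros Ht Hs.
  apply definable_iff with (fun e => exists x, x = t e /\ x = s e).
  - intros e. split.
    + intros [x [H K]]. congruence.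
    + intros H. eauto.
  - now apply definable_ex, definable_and.
Qed.

(** By extensionality, a graph is definable once membership in the values is. Variable 0 is the
    element and 1 the value, so the parameters start at 2. *)
Lemma definable_ext t (P : (nat -> V) -> V -> Prop) :
  (forall e x, x ∈ t e <-> P e x) ->
  definable (fun e => P (fun n => e (S (S n))) (e 0)) -> definable_term t.
Proof.
  intros H K.
  apply definable_iff with
    (fun e => forall x, x ∈ e 0 <-> P (fun n => e (S n)) x).
  - intros e. split.
    + intros L. apply extensionality. intros x. now rewrite L, H.
    + intros -> x. apply H.
  - apply definable_all, definable_equiv; [| exact K].
    apply definable_in; apply definable_var.
Qed.

Lemma definable_empty : definable_term (fun _ => ∅).
Proof.
  apply (definable_ext _ (fun _ x => x <> x)).
  - intros _ x. split; [intros H; now apply empty_spec in H | easy].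
  - apply definable_not, definable_eq; apply definable_var.
Qed.

Lemma definable_upair t s :
  definable_term t -> definable_term s -> definable_term (fun e => upair (t e) (s e)).
Proof.
  intros Ht Hs. apply (definable_ext _ (fun e x => x = t e \/ x = s e)).
  - intros e x. apply upair_spec.
  - apply definable_or; (apply definable_eq; [apply definable_var |]).
    + exact (definable_weaken _ (definable_weaken _ Ht)).
    + exact (definable_weaken _ (definable_weaken _ Hs)).
Qed.

Lemma definable_cup t s :
  definable_term t -> definable_term s -> definable_term (fun e => t e ∪ s e).
Proof.
  intros Ht Hs. apply (definable_ext _ (fun e x => x ∈ t e \/ x ∈ s e)).
  - intros e x. apply cup_spec.
  - apply definable_or; (apply definable_in; [apply definable_var |]).
    + exact (definable_weaken _ (definable_weaken _ Ht)).
    + exact (definable_weaken _ (definable_weaken _ Hs)).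
Qed.

Lemma definable_separation (P : (nat -> V) -> V -> Prop) (e : nat -> V) a :
  definable (fun e => P (fun n => e (S n)) (e 0)) ->
  exists c, forall x, x ∈ c <-> x ∈ a /\ P e x.
Proof.
  intros [phi K]. destruct (separation V phi e a) as [c Hc].
  exists c. intros x. rewrite Hc, (K (x .: e)). reflexivity.
Qed.

End Definability.

(** Only abbreviations are unfolded; [upair], [cup] and [empty] come from [setof], a choice outside
    the language, and enter through their graphs. *)
Ltac definable :=
  cbv beta delta [ranking inductive opair succ sing subset];
  repeat first
    [ apply definable_var | apply definable_empty
    | apply definable_upair | apply definable_cup
    | apply definable_not | apply definable_and | apply definable_or
    | apply definable_equiv | apply definable_imp
    | apply definable_all; cbv beta | apply definable_ex; cbv beta
    | apply definable_in | apply definable_eq ].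

(** * Pairs, natural numbers and ranking functions inside the model *)

Section Rank.
Context {V : ZFC}.
Implicit Types a b c d f n t u v w x y W : V.

Lemma upair_inj a b c : upair a b = upair a c -> b = c.
Proof.
  intros H.
  assert (Hb : b ∈ upair a c) by (rewrite <- H; apply upair_spec; tauto).
  assert (Hc : c ∈ upair a b) by (rewrite H; apply upair_spec; tauto).
  apply upair_spec in Hb, Hc. intuition congruence.
Qed.

Lemma opair_inj a b c d : opair a b = opair c d -> a = c /\ b = d.
Proof.
  unfold opair. intros H.
  assert (E : a = c).
  { assert (Ha : sing a ∈ upair (sing c) (upair c d))
      by (rewrite <- H; apply upair_spec; tauto).
    apply upair_spec in Ha.
    assert (Hc : c ∈ sing a)
      by (destruct Ha as [-> | ->]; [apply sing_spec | apply upair_spec]; tauto).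
    apply sing_spec in Hc. congruence. }
  subst c. split; [reflexivity |]. now apply upair_inj, upair_inj in H.
Qed.

Lemma succ_spec a x : x ∈ succ a <-> x ∈ a \/ x = a.
Proof. unfold succ. now rewrite cup_spec, sing_spec. Qed.

Lemma omega_spec n : n ∈ omega <-> forall w, inductive w -> n ∈ w.
Proof.
  apply (setof_spec V (fun n => forall w, inductive w -> n ∈ w)).
  (* Infinity supplies one inductive set, from which separation cuts out the intersection of all of
     them. *)
  destruct (infinity V) as [w [[z [Hz Ez]] Hs]].
  assert (Hw : inductive w).
  { split.
    - replace ∅ with z; [exact Hz |]. apply extensionality. intros x.
      split; intros H; [now apply Ez in H | now apply empty_spec in H].
    - intros x Hx. destruct (Hs x Hx) as [y [Hy Ey]].
      replace (succ x) with y; [exact Hy |]. apply extensionality. intros u.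
      now rewrite Ey, succ_spec. }
  destruct (definable_separation (V := V) (fun _ x => forall w, inductive w -> x ∈ w)
              (fun _ => ∅) w ltac:(definable)) as [c Hc].
  exists c. intros x. rewrite Hc. intuition.
Qed.

Lemma empty_in_omega : ∅ ∈ omega (V := V).
Proof. apply omega_spec. now intros w [H _]. Qed.

Lemma succ_in_omega n : n ∈ omega -> succ n ∈ omega.
Proof.
  rewrite !omega_spec. intros H w Hw. apply Hw. now apply H.
Qed.

Lemma omega_transitive n a : n ∈ omega -> a ∈ n -> a ⊆ n.
Proof.
  intros Hn. revert a.
  (* Induction inside the model: the good elements of [omega] form an inductive set [c]. *)
  destruct (definable_separation (V := V) (fun _ n => forall a, a ∈ n -> a ⊆ n)
              (fun _ => ∅) omega ltac:(definable)) as [c Hc].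
  apply (Hc n). apply (proj1 (omega_spec n) Hn). split.
  - apply Hc. split; [apply empty_in_omega |].
    intros a Ha. now apply empty_spec in Ha.
  - intros m Hm. apply Hc in Hm. destruct Hm as [Hm IH]. apply Hc.
    split; [now apply succ_in_omega |].
    intros a Ha x Hx. apply succ_spec. left. apply succ_spec in Ha.
    destruct Ha as [Ha | ->]; [exact (IH a Ha x Hx) | exact Hx].
Qed.

(** At an ∈-minimal argument of disagreement, the recursion equations would give both functions the
    same value. *)
Lemma ranking_unique f f' y b c :
  ranking f -> ranking f' -> opair y b ∈ f -> opair y c ∈ f' -> b = c.
Proof.
  intros [_ [F2 [F3 F4]]] [_ [G2 [G3 G4]]] Hb Hc. apply NNPP. intros N.
  (* With Kuratowski pairs, the double union [D] contains all arguments of [f]; it bounds the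
     separation below. *)
  destruct (unions V f) as [U HU]. destruct (unions V U) as [D HD].
  assert (dom : forall u d, opair u d ∈ f -> u ∈ D).
  { intros u d H. apply HD. exists (sing u). split; [| now apply sing_spec].
    apply HU. exists (opair u d). split; [exact H |]. apply upair_spec. tauto. }
  destruct (definable_separation (V := V)
    (fun e u => exists d d', opair u d ∈ e 0 /\ opair u d' ∈ e 1 /\ d <> d')
    (f .: f' .: fun _ => ∅) D ltac:(definable)) as [B HB]. cbn in HB.
  destruct (regularity V B) as [m [Hm Min]].
  { exists y. apply HB. split; [now apply dom with b |]. exists b, c. tauto. }
  apply HB in Hm. destruct Hm as [_ [d [d' [Hd [Hd' Nd]]]]]. apply Nd.
  assert (agree : forall u k k', u ∈ m -> opair u k ∈ f -> opair u k' ∈ f' -> k = k').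
  { intros u k k' Hu Hk Hk'. apply NNPP. intros M. apply (Min u Hu), HB.
    split; [now apply dom with k |]. exists k, k'. tauto. }
  apply extensionality. intros x. rewrite (F4 m d Hd x), (G4 m d' Hd' x).
  split; intros [u [k [Hu [Hk Hx]]]].
  - destruct (G3 m d' u Hd' Hu) as [k' Hk'].
    exists u, k'. pose proof (agree u k k' Hu Hk Hk'). subst k'. tauto.
  - destruct (F3 m d u Hd Hu) as [k' Hk'].
    exists u, k'. pose proof (agree u k' k Hu Hk' Hk). subst k'. tauto.
Qed.

(** By uniqueness, any one ranking function that reaches [x] determines the value chosen by
    [epsilon]. *)
Lemma ranking_rk f x b : ranking f -> opair x b ∈ f -> rk x = b.
Proof.
  intros Hf Hb. unfold rk.
  destruct (epsilon_spec (ZFC_inhabited V)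
    (fun b => exists f, ranking f /\ opair x b ∈ f)) as [f' [Hf' Hb']].
  - now exists b, f.
  - exact (ranking_unique _ _ _ _ _ Hf' Hf Hb' Hb).
Qed.

Lemma ranking_decreasing f u v a b :
  ranking f -> opair u a ∈ f -> opair v b ∈ f -> v ∈ u -> b ∈ a.
Proof.
  intros [_ [_ [_ F4]]] Ha Hb Hv. apply (F4 u a Ha). exists v, b.
  repeat split; trivial. apply succ_spec. tauto.
Qed.

(** The values on members of [u] are at most [n] and [v] attains [n], so the union of their
    successors is n + 1. *)
Lemma ranking_extend f u v n :
  ranking f -> n ∈ omega -> v ∈ u -> opair v n ∈ f ->
  (forall w, w ∈ u -> exists d, opair w d ∈ f /\ d ∈ succ n) ->
  exists f', ranking f' /\ f ⊆ f' /\ opair u (succ n) ∈ f'.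
Proof.
  intros Hf Hn Hv Hvn Hu. destruct Hf as [F1 [F2 [F3 F4]]].
  assert (E : forall c, c ∈ succ n <-> exists w d, w ∈ u /\ opair w d ∈ f /\ c ∈ succ d).
  { intros c. split.
    - intros Hc. now exists v, n.
    - intros [w [d [Hw [Hd Hc]]]]. destruct (Hu w Hw) as [d' [Hd' Hdn]].
      rewrite (F2 _ _ _ Hd Hd') in Hc. apply succ_spec in Hc.
      destruct Hc as [Hc | ->]; [| exact Hdn].
      exact (omega_transitive _ _ (succ_in_omega _ Hn) Hdn c Hc). }
  destruct (classic (exists d, opair u d ∈ f)) as [[d Hd] | N].
  - exists f. repeat split; trivial; [apply F4; trivial | apply F4; trivial | easy |].
    replace (succ n) with d; [exact Hd |]. apply extensionality. intros c.
    rewrite E. now apply F4.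
  - exists (f ∪ sing (opair u (succ n))).
    assert (S : forall y b, opair y b ∈ f ∪ sing (opair u (succ n)) <->
                  opair y b ∈ f \/ y = u /\ b = succ n).
    { intros y b. rewrite cup_spec, sing_spec. split; intros [H | H]; try tauto.
      - right. now apply opair_inj.
      - right. now destruct H as [-> ->]. }
    assert (nu : forall y b, y = u -> opair y b ∈ f -> False).
    { intros y b -> H. apply N. now exists b. }
    (* The new pair feeds no recursion equation: all members of [u] and of old arguments are old
       arguments, and [u] is not one. *)
    assert (old : forall y w d, (y = u \/ exists b, opair y b ∈ f) -> w ∈ y ->
              opair w d ∈ f ∪ sing (opair u (succ n)) -> opair w d ∈ f).
    { intros y w d Hy Hw Hd. apply S in Hd. destruct Hd as [Hd | [-> _]]; [exact Hd |].
      exfalso. destruct Hy as [-> | [b Hb]].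
      - destruct (Hu u Hw) as [k [Hk _]]. now apply (nu u k).
      - destruct (F3 y b u Hb Hw) as [k Hk]. now apply (nu u k). }
    split; [split; [| split; [| split]] | split].
    + intros p Hp. apply cup_spec in Hp. destruct Hp as [Hp | Hp]; [now apply F1 |].
      apply sing_spec in Hp. eauto.
    + intros y b c Hb Hc. apply S in Hb, Hc.
      destruct Hb as [Hb | [Ey ->]], Hc as [Hc | [Ey' ->]].
      * exact (F2 _ _ _ Hb Hc).
      * now destruct (nu _ _ Ey' Hb).
      * now destruct (nu _ _ Ey Hc).
      * reflexivity.
    + intros y b w Hb Hw. apply S in Hb. destruct Hb as [Hb | [-> ->]].
      * destruct (F3 _ _ _ Hb Hw) as [d Hd]. exists d. apply S. now left.
      * destruct (Hu w Hw) as [d [Hd _]]. exists d. apply S. now left.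
    + intros y b Hb c.
      assert (Hy : y = u \/ exists b, opair y b ∈ f).
      { apply S in Hb. destruct Hb as [Hb | [-> _]]; eauto. }
      transitivity (exists w d, w ∈ y /\ opair w d ∈ f /\ c ∈ succ d).
      * apply S in Hb. destruct Hb as [Hb | [-> ->]]; [now apply F4 | apply E].
      * split; intros [w [d [Hw [Hd Hc]]]]; exists w, d; repeat split; trivial.
        -- apply S. now left.
        -- exact (old y w d Hy Hw Hd).
    + intros p Hp. apply cup_spec. now left.
    + apply S. now right.
Qed.

Lemma ranking_sing_empty : ranking (sing (opair (∅ : V) ∅)).
Proof.
  assert (S : forall y b : V, opair y b ∈ sing (opair ∅ ∅) -> y = ∅ /\ b = ∅).
  { intros y b H. now apply sing_spec, opair_inj in H. }
  split; [| split; [| split]].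
  - intros p Hp. apply sing_spec in Hp. eauto.
  - intros y b c Hb Hc. apply S in Hb, Hc. intuition congruence.
  - intros y b u Hb Hu. apply S in Hb. destruct Hb as [-> _].
    now apply empty_spec in Hu.
  - intros y b Hb c. apply S in Hb. destruct Hb as [-> ->]. split.
    + intros H. now apply empty_spec in H.
    + intros [u [_ [H _]]]. now apply empty_spec in H.
Qed.

(** * Sets generated from ∅ by [u ↦ {∅, u}] *)

(** Closure under [upair ∅] is not demanded: the generation may stop at a top element [b] with
    [upair ∅ b] outside [W]. *)
Definition generated W : Prop :=
  ∅ ∈ W /\ forall y, y ∈ W -> y = ∅ \/ exists u, u ∈ W /\ y = upair ∅ u.

Lemma generated_transitive W y x : generated W -> y ∈ W -> x ∈ y -> x ∈ W.
Proof.
  intros [H0 HW] Hy Hx. destruct (HW y Hy) as [-> | [u [Hu ->]]].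
  - now apply empty_spec in Hx.
  - apply upair_spec in Hx. now destruct Hx as [-> | ->].
Qed.

(** An ∈-minimal element of [W ∖ c] would be some {∅, u}, with its member [u] already in [c]. *)
Lemma generated_ind W c :
  generated W -> ∅ ∈ c ->
  (forall u, u ∈ W -> u ∈ c -> upair ∅ u ∈ W -> upair ∅ u ∈ c) -> W ⊆ c.
Proof.
  intros [H0 HW] Hc Hg x Hx. apply NNPP. intros N.
  destruct (regularity V (W ∖ c)) as [m [Hm Min]].
  { exists x. now apply setminus_spec. }
  apply setminus_spec in Hm. destruct Hm as [Hm Nm]. apply Nm.
  destruct (HW m Hm) as [-> | [u [Hu ->]]]; [exact Hc |].
  apply Hg; trivial. apply NNPP. intros Nu. apply (Min u).
  - apply upair_spec. tauto.
  - now apply setminus_spec.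
Qed.

(** Downward induction from the top [b]. The least candidate [A] for [t] inside [W] is closed under
    [upair ∅] within [W], hence exhausts [W]. *)
Lemma generated_top W b t :
  generated W -> b ∈ W -> upair ∅ b ∉ W -> b ∈ t ->
  (forall y x, y ∈ W -> y ∈ t -> x ∈ y -> x ∈ t) -> W ⊆ t.
Proof.
  intros HW Hb Nb Hbt Ht.
  destruct (definable_separation (V := V)
    (fun e x => forall t, e 0 ∈ t ->
       (forall y x, y ∈ e 1 -> y ∈ t -> x ∈ y -> x ∈ t) -> x ∈ t)
    (b .: W .: fun _ => ∅) W ltac:(definable)) as [A HA]. cbn in HA.
  assert (bA : b ∈ A) by now apply HA.
  assert (AW : A ⊆ W) by (intros x Hx; now apply HA in Hx).
  assert (trA : forall y x, y ∈ A -> x ∈ y -> x ∈ A).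
  { intros y x Hy Hx. apply HA in Hy. destruct Hy as [Hy My]. apply HA.
    split; [exact (generated_transitive _ _ _ HW Hy Hx) |].
    intros s Hs Cs. exact (Cs y x Hy (My s Hs Cs) Hx). }
  assert (WA : W ⊆ A).
  { apply generated_ind; trivial.
    (* A minimal element of [A] cannot be some {∅, u}, since its member ∅ would lie in the
       transitive set [A]. *)
    - destruct (regularity V A) as [m [Hm Min]]; [now exists b |].
      destruct (proj2 HW m (AW m Hm)) as [-> | [u [_ ->]]]; [exact Hm |].
      destruct (Min ∅).
      + apply upair_spec. tauto.
      + apply (trA _ _ Hm). apply upair_spec. tauto.
    - intros u Hu HuA Hgu.
      (* The case ∅ is separate because ∅ belongs to every {∅, v}, so that removing it can destroy
         transitivity. *)
      destruct (classic (u = ∅)) as [-> | Nu].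
      + (* the least nonempty element of [A], if there is one, is [{∅}] *)
        destruct (classic (exists x, x ∈ A ∖ sing ∅)) as [NE | NE].
        * destruct (regularity V _ NE) as [m [Hm Min]].
          apply setminus_spec in Hm. destruct Hm as [Hm Nm].
          rewrite sing_spec in Nm.
          destruct (proj2 HW m (AW m Hm)) as [E | [v [_ ->]]]; [easy |].
          assert (Hv : v ∈ upair ∅ v) by (apply upair_spec; tauto).
          destruct (classic (v = ∅)) as [-> | Nv]; [exact Hm |].
          destruct (Min v Hv). apply setminus_spec.
          split; [exact (trA _ _ Hm Hv) | now rewrite sing_spec].
        * assert (E : b = ∅).
          { apply NNPP. intros Nb0. apply NE. exists b. apply setminus_spec.
            split; [exact bA | now rewrite sing_spec]. }
          now subst b.
      + (* otherwise [A ∖ {u}] is a smaller transitive set containing [b] *)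
        apply NNPP. intros NgA. apply HA in HuA.
        assert (K : u ∈ A ∖ sing u).
        { apply (proj2 HuA).
          - apply setminus_spec. split; [exact bA |]. rewrite sing_spec. congruence.
          - intros y x Hy HyA Hx. apply setminus_spec in HyA. destruct HyA as [HyA _].
            apply setminus_spec. split; [exact (trA _ _ HyA Hx) |].
            rewrite sing_spec. intros ->.
            (* As [u] is nonempty, [y] can only be {∅, u}, which [NgA] keeps out of [A]. *)
            destruct (proj2 HW y Hy) as [-> | [v [_ ->]]];
              [now apply empty_spec in Hx |].
            apply upair_spec in Hx. destruct Hx as [-> | ->]; easy. }
        apply setminus_spec in K. apply (proj2 K). now apply sing_spec. }
  intros x Hx. apply (proj1 (HA x) (WA x Hx)); trivial.
Qed.

(** A second top [b'] ≠ ∅ could only be a member of {∅, b'}, which is not in [W]. So [W ∖ sing b']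
    is closed under members of elements of [W] and contains [b], against [generated_top]. *)
Lemma generated_top_unique W b b' :
  generated W -> b ∈ W -> upair ∅ b ∉ W -> b' ∈ W -> upair ∅ b' ∉ W -> b = b'.
Proof.
  assert (main : forall b b', generated W -> b ∈ W -> upair ∅ b ∉ W ->
            b' ∈ W -> upair ∅ b' ∉ W -> b' <> ∅ -> b = b').
  { clear b b'. intros b b' HW Hb Nb Hb' Nb' N0. apply NNPP. intros N.
    assert (K : W ⊆ W ∖ sing b').
    { apply (generated_top W b); trivial.
      - apply setminus_spec. split; [exact Hb | now rewrite sing_spec].
      - intros y x Hy _ Hx. apply setminus_spec.
        split; [exact (generated_transitive _ _ _ HW Hy Hx) |].
        rewrite sing_spec. intros ->.
        destruct (proj2 HW y Hy) as [-> | [v [_ ->]]]; [now apply empty_spec in Hx |].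
        apply upair_spec in Hx. destruct Hx as [-> | ->]; easy. }
    apply K, setminus_spec in Hb'. apply (proj2 Hb'). now apply sing_spec. }
  intros HW Hb Nb Hb' Nb'.
  (* [main] needs its second top nonempty; of two distinct tops, at least one is. *)
  destruct (classic (b' = ∅)) as [E' | N']; [| now apply main].
  destruct (classic (b = ∅)) as [E | N]; [congruence |].
  symmetry. now apply main.
Qed.

Lemma generated_ranking W y :
  generated W -> y ∈ W -> exists f n, ranking f /\ n ∈ omega /\ opair y n ∈ f.
Proof.
  intros HW Hy.
  (* [omega] enters as a parameter, which spares a formula for it. *)
  destruct (definable_separation (V := V)
    (fun e y => exists f n, ranking f /\ n ∈ e 0 /\ opair y n ∈ f)
    (omega .: fun _ => ∅) W ltac:(definable)) as [c Hc]. cbn in Hc.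
  apply Hc. revert y Hy. apply generated_ind; trivial.
  - apply Hc. split; [apply HW |]. exists (sing (opair ∅ ∅)), ∅.
    split; [apply ranking_sing_empty |].
    split; [apply empty_in_omega | now apply sing_spec].
  - intros u Hu Huc Hgu. apply Hc. split; [exact Hgu |].
    apply Hc in Huc. destruct Huc as [_ [f [n [Hf [Hn Hun]]]]].
    destruct (ranking_extend f (upair ∅ u) u n) as [f' [Hf' [_ H]]]; trivial.
    + apply upair_spec. tauto.
    + intros w Hw. apply upair_spec in Hw.
      (* Both members of {∅, u} have rank at most that of [u], since ∅ is [u] or a member of [u]. *)
      assert (Eu : w = u \/ w ∈ u).
      { destruct Hw as [-> | ->]; [| tauto].
        destruct (proj2 HW u Hu) as [-> | [v [_ ->]]]; [tauto |].
        right. apply upair_spec. tauto. }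
      destruct Eu as [-> | Hwu].
      * exists n. split; [exact Hun | apply succ_spec; tauto].
      * destruct (proj1 (proj2 (proj2 Hf)) u n w Hun Hwu) as [d Hd].
        exists d. split; [exact Hd |]. apply succ_spec. left.
        exact (ranking_decreasing _ _ _ _ _ Hf Hun Hd Hwu).
    + exists f', (succ n). split; [exact Hf' |]. split; [| exact H].
      now apply succ_in_omega.
Qed.

(** A single function reaching [b] serves all of [W]: having a value at most [n] passes to members,
    and downward induction from [b] covers [W]. *)
Lemma generated_ranking_top W b :
  generated W -> b ∈ W -> upair ∅ b ∉ W ->
  exists f n, ranking f /\ n ∈ omega /\ opair b n ∈ f /\
    forall u, u ∈ W -> exists d, opair u d ∈ f /\ d ∈ succ n.
Proof.
  intros HW Hb Nb.
  destruct (generated_ranking W b HW Hb) as [f [n [Hf [Hn Hbn]]]].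
  exists f, n. split; [exact Hf |]. split; [exact Hn |]. split; [exact Hbn |].
  destruct (definable_separation (V := V)
    (fun e u => exists d, opair u d ∈ e 0 /\ d ∈ succ (e 1))
    (f .: n .: fun _ => ∅) W ltac:(definable)) as [c Hc]. cbn in Hc.
  intros u Hu. apply Hc. revert u Hu. apply (generated_top W b); trivial.
  - apply Hc. split; [exact Hb |]. exists n.
    split; [exact Hbn | apply succ_spec; tauto].
  - intros y x Hy Hyc Hx. apply Hc in Hyc. destruct Hyc as [_ [d [Hd Hdn]]].
    apply Hc. split; [exact (generated_transitive _ _ _ HW Hy Hx) |].
    destruct (proj1 (proj2 (proj2 Hf)) y d x Hd Hx) as [k Hk].
    exists k. split; [exact Hk |].
    apply (omega_transitive _ _ (succ_in_omega _ Hn) Hdn).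
    exact (ranking_decreasing _ _ _ _ _ Hf Hd Hk Hx).
Qed.

End Rank.

(** * The equation for [Y] and [Z] *)

Theorem theorem1 (V : ZFC) (Y Z : V)
    (hprod : sing ∅ ⊗ (sing ∅ ∪ Y) = Z)
    (hproper : Y ⊊ Z) :
  rk Z ∈ omega /\ exists! x, x ∈ Z ∖ Y.
Proof.
  destruct hproper as [YZ NYZ].
  set (W := sing ∅ ∪ Y) in hprod.
  assert (inW : forall x, x ∈ W <-> x = ∅ \/ x ∈ Y).
  { intros x. unfold W. now rewrite cup_spec, sing_spec. }
  assert (inZ : forall x, x ∈ Z <-> exists u, u ∈ W /\ x = upair ∅ u).
  { intros x. rewrite <- hprod, uprod_spec. split.
    - intros [a [u [Ha [Hu ->]]]]. apply sing_spec in Ha. subst a. eauto.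
    - intros [u [Hu ->]]. exists ∅, u. now rewrite sing_spec. }
  assert (HW : generated W).
  { split; [apply inW; tauto |]. intros y Hy. apply inW in Hy.
    destruct Hy as [-> | Hy]; [tauto |]. right. now apply inZ, YZ. }
  assert (diff : forall x, x ∈ Z ∖ Y <-> exists u, u ∈ W /\ x = upair ∅ u /\ x ∉ W).
  { intros x. rewrite setminus_spec, inZ. split.
    - intros [[u [Hu ->]] N]. exists u. repeat split; trivial.
      (* Elements of [Z] are nonempty, so for them lying in [W] and lying in [Y] agree. *)
      rewrite inW. intros [E | H]; [| easy].
      apply (empty_spec (V := V) ∅). rewrite <- E at 2. apply upair_spec. tauto.
    - intros [u [Hu [-> N]]]. split; [eauto |]. rewrite inW in N. tauto. }
  assert (NE : exists x, x ∈ Z ∖ Y).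
  { apply NNPP. intros N. apply NYZ, extensionality. intros x. split; [apply YZ |].
    intros Hx. apply NNPP. intros Nx. apply N. exists x. now apply setminus_spec. }
  destruct NE as [x0 H0]. pose proof H0 as H1. apply diff in H1.
  destruct H1 as [b [Hb [-> Nb]]]. split.
  - destruct (generated_ranking_top W b HW Hb Nb) as [f [n [Hf [Hn [Hbn Hd]]]]].
    (* Two extensions: {∅, b} receives n + 1, then [Z], which contains it, receives n + 2. *)
    destruct (ranking_extend f (upair ∅ b) b n) as [f1 [Hf1 [I1 K1]]]; trivial.
    { apply upair_spec. tauto. }
    { intros w Hw. apply upair_spec in Hw. apply Hd.
      destruct Hw as [-> | ->]; [apply HW | exact Hb]. }
    destruct (ranking_extend f1 Z (upair ∅ b) (succ n)) as [f2 [Hf2 [_ K2]]]; trivial.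
    { now apply succ_in_omega. }
    { apply setminus_spec in H0. tauto. }
    { intros w Hw.
      (* Elements of [Z] in [W] have rank at most [n]; by uniqueness of the top the only other one
         is {∅, b}. *)
      destruct (classic (w ∈ W)) as [HwW | NwW].
      - destruct (Hd w HwW) as [d [Hwd Hdn]]. exists d.
        split; [now apply I1 | apply succ_spec; tauto].
      - apply inZ in Hw. destruct Hw as [u [Hu ->]].
        rewrite (generated_top_unique W u b HW Hu NwW Hb Nb).
        exists (succ n). split; [exact K1 | apply succ_spec; tauto]. }
    rewrite (ranking_rk _ _ _ Hf2 K2). now apply succ_in_omega, succ_in_omega.
  - exists (upair ∅ b). split; [exact H0 |]. intros x Hx. apply diff in Hx.
    destruct Hx as [u [Hu [-> Nu]]].
    now rewrite (generated_top_unique W u b HW Hu Nu Hb Nb).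
Qed.
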